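(* Let $G$ be a finite group of odd order. Then $\Delta(G)$ is triangle-free if and only if one of the following cases occurs: (1) $G$ is a $3$-group of exponent $3$; (2) $G$ is a Frobenius group of order $3\cdot 7^a$ for a positive integer $a$, where the Frobenius kernel $N$ has exponent $7$ and for every nontrivial element $1\ne x\in N$, the normalizer $N_G(\langle x\rangle)$ contains a Frobenius complement of $G$, which has order $3$.
   Context: All groups are finite. For a group $G$, the cyclic conjugacy class graph $\Delta(G)$ is the simple undirected graph whose vertices are the nontrivial conjugacy classes of $G$ (the classes $x^G$ with $1\ne x\in G$), where two distinct vertices $x^G$ and $y^G$ are adjacent when there exist $x'\in x^G$ and $y'\in y^G$ such that the subgroup $\langle x',y'\rangle$ is cyclic. A graph is triangle-free if it does not contain three distinct pairwise adjacent vertices.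
   Formalization: In case (1), ''exponent 3'' is read as exponent dividing 3, so the trivial group is included: it has odd order and an empty, hence triangle-free, graph, but literally satisfies neither case. *)

(* Defs.v *)
From mathcomp Require Import all_boot all_fingroup all_solvable.

Set Implicit Arguments.
Unset Strict Implicit.
Unset Printing Implicit Defensive.

Local Open Scope group_scope.

(* A simple graph is given by its vertex set V inside a finite type T and an
   adjacency relation on T, of which only the restriction to V matters. *)
Definition triangle_free (T : finType) (V : {set T}) (adj : rel T) : Prop :=
  ~ exists x y z : T,
      [/\ [/\ x \in V, y \in V & z \in V],
          [/\ x != y, y != z & x != z]
        & [/\ adj x y, adj y z & adj x z]].

Definition nontrivial_classes (gT : finGroupType) (G : {group gT}) :
    {set {set gT}} :=
  [set x ^: G | x in G^#].

Definition cyclic_class_adj (gT : finGroupType) : rel {set gT} :=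
  fun C D =>
    (C != D) && [exists x in C, exists y in D, cyclic <<[set x; y]>>].

Definition cyclic_class_graph_triangle_free
    (gT : finGroupType) (G : {group gT}) : Prop :=
  triangle_free (nontrivial_classes G) (@cyclic_class_adj gT).

(* Main.v *)
Require Import Defs.
From mathcomp Require Import all_boot all_fingroup all_solvable all_algebra.
From mathcomp Require Import integral_char zify.

Set Implicit Arguments.
Unset Strict Implicit.
Unset Printing Implicit Defensive.

Import FiniteModule.
Local Open Scope group_scope.

(* Since G has odd order, a nontrivial x is never conjugate to x^-1, so that
   triangle-freeness says exactly that every nontrivial power of x is conjugate
   to x or to x^-1. Hence x has prime order p; if k is a primitive root mod p,
   some g in G maps x to x^k or x^-k, and the (prime) order r of g satisfies
   p - 1 | 2r, whence p = 3 or p = 2r + 1. As 15 is not a prime, only 3 and 7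
   occur. By Burnside's p^a q^b theorem G is soluble; if 7 divides #|G|, let V
   be a minimal normal subgroup. An averaging argument shows that V is a
   7-group, and then that a Sylow 3-subgroup has order 3; a Sylow 7-subgroup has
   then index 3, and it is normal by Sylow's counting theorem. *)

(** The unit group of ['Z_p] is cyclic of order [p.-1]; [k] represents a generator. *)
Lemma primitive_root_mod_prime p : prime p ->
  exists2 k, coprime k p & forall m, k ^ m = 1 %[mod p] -> p.-1 %| m.
Proof.
move=> pr_p; have p_gt1 := prime_gt1 pr_p; have p_gt0 := ltnW p_gt1.
have /cyclicP[u defU] := units_Zp_cyclic pr_p.
have ordu: #[u] = p.-1.
  by rewrite /order -defU card_units_Zp // totient_prime.
have [k defk]: exists k : nat, (k%:R : 'Z_p)%R = FinRing.uval u.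
  by exists (FinRing.uval u); apply: natr_Zp.
exists k => [|m km1].
  have: (FinRing.uval u : 'Z_p) \is a GRing.unit := valP u.
  by rewrite -defk unitZpE // coprime_sym.
rewrite -ordu order_dvdn; apply/eqP/val_inj.
rewrite FinRing.val_unitX /= -defk -GRing.natrX.
by rewrite -Zp_nat_mod // km1 Zp_nat_mod.
Qed.

(** * Triangle-freeness as a fusion condition, and the resulting element orders *)

Section OddGroups.

Variables (gT : finGroupType) (G : {group gT}).
Implicit Types (x y z g h : gT).

Definition fused_powers :=
  forall x y, x \in G -> y \in <[x]> -> y != 1 ->
    y \in x ^: G \/ y^-1 \in x ^: G.

(** Odd powers of an element [g] inverting [x] also invert [x]. As [#[g]] is odd, the trivial power
    is one of them, so [x] equals its inverse. *)
Lemma odd_class_inv x : odd #|G| -> x \in G -> x^-1 \in x ^: G -> x = 1.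
Proof.
move=> oddG Gx /imsetP[g Gg xg].
have xgm m : x ^ (g ^+ m) = if odd m then x^-1 else x.
  elim: m => [|m IHm] /=; first by rewrite conjg1.
  by rewrite expgSr conjgM IHm; case: (odd m); rewrite /= ?conjVg -xg ?invgK.
have := xgm #[g]; rewrite expg_order conjg1 (dvdn_odd (order_dvdG Gg)) // => xV.
have /eqP: x ^+ 2 = 1 by rewrite expgS expg1 {1}xV mulVg.
rewrite -order_dvdn => /(dvdn_leq _) => /(_ isT) o2.
have oddx := dvdn_odd (order_dvdG Gx) oddG.
apply/eqP; rewrite -order_eq1; move: o2 oddx (order_gt0 x).
by case: #[x] => [|[|[|]]].
Qed.

(** If a nontrivial power [y] of [x] is conjugate to neither [x] nor its inverse, the classes of
    [x], [x^-1] and [y] form a triangle. Conversely, fusion leaves the inverse class as the only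
    possible neighbour of a vertex. *)
Lemma triangle_free_fused_powers :
  odd #|G| -> cyclic_class_graph_triangle_free G <-> fused_powers.
Proof.
move=> oddG; split=> [tfG x y Gx xy nty | fG [C [D [E]]]].
  case xGy: (y \in x ^: G); first by left.
  case xGVy: (y^-1 \in x ^: G); first by right.
  have ntx: x != 1.
    by apply: contraNneq nty => x1; move: xy; rewrite x1 cycle1 => /set1P->.
  have Gy: y \in G by apply: subsetP xy; rewrite cycle_subG.
  have adjP u v : u \in <[x]> -> v \in <[x]> -> u \notin v ^: G ->
    cyclic_class_adj (u ^: G) (v ^: G).
  - move=> xu xv uv; apply/andP; split.
      by apply: contraNneq uv => /class_eqP.
    apply/existsP; exists u; rewrite class_refl; apply/existsP; exists v.
    rewrite class_refl; apply: cyclicS (cycle_cyclic x).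
    by rewrite gen_subG; apply/subsetP=> w /set2P[]->.
  have xVx : x \notin x^-1 ^: G.
    apply: contra ntx; rewrite class_sym => xV; apply/eqP.
    exact: odd_class_inv xV.
  have yVx : y \notin x^-1 ^: G by rewrite classVg mem_invg xGVy.
  case: tfG; exists (x ^: G), (x^-1 ^: G), (y ^: G); split.
  - by split; apply: imset_f; rewrite !inE ?invg_eq1 ?ntx ?nty ?groupV.
  - by split; apply/eqP => /class_eqP; apply/negP=> //;
    rewrite class_sym // xGy.
  split; apply: adjP; rewrite ?groupV ?cycle_id //.
  - by rewrite class_sym.
  - by rewrite class_sym xGy.
have adjV A B : A \in nontrivial_classes G -> B \in nontrivial_classes G ->
  cyclic_class_adj A B -> B = A^-1.
- case/imsetP=> a /setD1P[nta Ga] -> /imsetP[b /setD1P[ntb Gb] ->].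
  case/andP=> neAB /existsP[u /andP[/class_eqP Au]].
  case/existsP=> v /andP[/class_eqP Bv] /cyclicP[w defw].
  have [wu wv]: u \in <[w]> /\ v \in <[w]>.
    by rewrite -defw !mem_gen // !inE eqxx ?orbT.
  have Gu: u \in G.
    by rewrite (subsetP (class_subG Ga (subxx G))) // -Au class_refl.
  have Gv: v \in G.
    by rewrite (subsetP (class_subG Gb (subxx G))) // -Bv class_refl.
  have sw: <[w]> \subset G.
    by rewrite -defw gen_subG; apply/subsetP=> t /set2P[]->.
  have Gw: w \in G by rewrite -cycle_subG.
  have ntu: u != 1.
    by apply: contraNneq nta => u1; rewrite -(classG_eq1 G) -Au u1 class1G.
  have ntv: v != 1.
    by apply: contraNneq ntb => v1; rewrite -(classG_eq1 G) -Bv v1 class1G.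
  (* Both classes are compared with that of a common generator [w]; being distinct, they must be
     mutually inverse. *)
  have cls t : t \in <[w]> -> t != 1 -> t ^: G = w ^: G \/ t ^: G = (w ^: G)^-1.
    move=> wt ntt; case: (fG w t Gw wt ntt) => /class_eqP; first by left.
    by rewrite classVg => <-; rewrite invgK; right.
  move: neAB; rewrite -Au -Bv.
  case: (cls u wu ntu) => ->; case: (cls v wv ntv) => ->;
    by rewrite ?invgK ?eqxx.
case=> [[cC cD cE] [neCD neDE neCE] [aCD aDE aCE]].
by case/eqP: neDE; rewrite (adjV C D) // (adjV C E).
Qed.

Hypotheses (oddG : odd #|G|) (fG : fused_powers).

(** Some power of [x] has prime order, and it or its inverse is conjugate to [x]. *)
Lemma fused_powers_prime_order x : x \in G -> x != 1 -> prime #[x].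
Proof.
move=> Gx ntx; have x_gt1: 1 < #[x] by rewrite order_gt1.
have pr_p := pdiv_prime x_gt1; have p_dv := pdiv_dvd #[x].
set p := pdiv #[x] in pr_p p_dv.
pose y := x ^+ (#[x] %/ p).
have oy : #[y] = p.
  by rewrite /y orderXdiv ?dvdn_div // divnA // mulKn.
have nty: y != 1 by rewrite -order_gt1 oy prime_gt1.
suff ->: #[x] = #[y] by rewrite oy.
case: (fG Gx (mem_cycle x _) nty) => /imsetP[g _] defy.
  by rewrite /y defy orderJ.
by rewrite -[RHS]orderV /y defy orderJ.
Qed.

Lemma fused_powers_normalizer x : x \in G -> x != 1 ->
  #[x] = 3 \/ exists2 g, g \in G /\ prime #[g] &
               [/\ #[x] = #[g].*2.+1, x ^ g \in <[x]> & x ^ g != x].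
Proof.
move=> Gx ntx; have pr_p := fused_powers_prime_order Gx ntx.
have oddp : odd #[x] := dvdn_odd (order_dvdG Gx) oddG.
have [k cokp primk] := primitive_root_mod_prime pr_p.
have ntxk: x ^+ k != 1.
  by rewrite -order_dvdn -prime_coprime // coprime_sym.
have [g Gg xg]: exists2 g, g \in G & x ^ g = x ^+ k \/ x ^ g = (x ^+ k)^-1.
  by case: (fG Gx (mem_cycle x k) ntxk) => /imsetP[g Gg ->]; exists g; auto.
(* Even powers of [g] remove the sign ambiguity between [x ^+ k] and its inverse. *)
have xg2 m : x ^ (g ^+ m.*2) = x ^+ (k ^ m.*2).
  elim: m => [|m IHm]; first by rewrite conjg1.
  rewrite doubleS !expgSr !conjgM {}IHm !conjXg -conjgM.
  case: xg => xg; rewrite conjgM !xg ?conjVg conjXg xg.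
    by rewrite -!expgM !expnS mulnA mulnC.
  by rewrite -[x ^- k ^- k]expgVn invgK -!expgM !expnS mulnA mulnC.
have per m : x ^ (g ^+ m.*2) = x -> #[x].-1 %| m.*2.
  rewrite xg2 => xk; apply: primk; apply/eqP; rewrite -eq_expg_mod_order.
  by rewrite xk expg1.
have xgx: x ^ g \in <[x]>.
  by case: xg => ->; rewrite ?groupV mem_cycle.
have defx: #[x] = #[x].-1./2.*2.+1 by have := prime_gt1 pr_p; lia.
have [|xn3] := eqVneq #[x] 3; [by left | right].
have xgne: x ^ g != x.
  apply: contra xn3 => /eqP xgeq; apply/eqP.
  have /dvdn_leq: #[x].-1 %| 1%N.*2 by apply: per; rewrite expgS conjgM !xgeq.
  by move/(_ isT); have := prime_gt1 pr_p; lia.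
have pr_g: prime #[g].
  apply: fused_powers_prime_order => //.
  by apply: contraNneq xgne => ->; rewrite conjg1.
exists g => //; split=> //.
(* Since [#[g]] is prime, this divisor is either 1, which is excluded by [#[x] != 3], or [#[g]]
   itself. *)
have: #[x].-1./2 %| #[g].
  have := per #[g]; rewrite -muln2 expgM expg_order expg1n conjg1 => /(_ erefl).
  by rewrite {1}defx /= -muln2 dvdn_pmul2r.
case/primeP: pr_g => _ dvg /dvg /orP[]/eqP ho; last by rewrite -ho.
by case/eqP: xn3; rewrite defx ho.
Qed.

(** Induction on the order: when [#[x]] is not 3, it is [2r + 1] with [r] the order of a nontrivial
    element, so [r] is 3 or 7, and 7 would give 15. *)
Lemma fused_powers_order x : x \in G -> x != 1 ->
  #[x] = 3 \/ #[x] = 7 /\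
               exists h, [/\ h \in G, #[h] = 3, x ^ h \in <[x]> & x ^ h != x].
Proof.
have [n] := ubnP #[x]; elim: n x => // n IHn x xn Gx ntx.
have pr_x := fused_powers_prime_order Gx ntx.
have [-> | [g [Gg pr_g] [ox xgx xgne]]] := fused_powers_normalizer Gx ntx.
  by left.
have ntg: g != 1 by rewrite -order_gt1 prime_gt1.
case: (IHn g) => // [|og|[og _]]; last by rewrite ox og in pr_x.
  by move: xn; rewrite ox ltnS; apply: leq_trans; rewrite ltnS -addnn leq_addr.
by right; rewrite ox og; split=> //; exists g.
Qed.

End OddGroups.

(** * Averaging over a coset of a group acting without fixed points *)

(* Additively, sum v + v^g + v^(g^-1) = 0 over g in hZ: both sums of conjugates
   are conjugates of sums over Z, which are fixed by Z and therefore vanish. *)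
Lemma expg_card_fixfree (gT : finGroupType) (V Z : {group gT}) (h : gT) :
    abelian V -> Z \subset 'N(V) -> h \in 'N(V) -> 'C_V(Z) = 1 ->
    (forall g v, g \in h *: Z -> v \in V -> v * v ^ g * v ^ g^-1 = 1) ->
  forall v, v \in V -> v ^+ #|Z| = 1.
Proof.
move=> abV nVZ nVh cVZ1 normv v Vv.
have sumZ (u : fmod_of abV) : (\sum_(z in Z) actr u z = 0)%R.
  apply/val_inj/set1gP; rewrite -cVZ1 inE fmodP; apply/centP=> y Zy.
  apply/commgP/conjg_fixP; have nVy := subsetP nVZ y Zy.
  rewrite -(fmvalJ _ nVy) actr_sum; congr (val _).
  rewrite [RHS](reindex_inj (mulIg y)) /=.
  apply: eq_big => [z | z Zz]; first by rewrite groupMr.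
  by rewrite actrM // (subsetP nVZ).
pose u := fmod abV v.
have: (\sum_(z in Z) (u + actr u (h * z)%g + actr u (h * z)^-1%g) = 0)%R.
  rewrite big1 // => z Zz; apply: val_inj.
  have nVhz: h * z \in 'N(V) by apply: groupM; rewrite // (subsetP nVZ).
  rewrite -[LHS]/(val u * val (actr u (h * z)) * val (actr u (h * z)^-1)).
  rewrite !fmvalJ ?groupV // fmodK //.
  by apply: normv; rewrite // mem_lcoset mulKg.
rewrite !big_split /=.
have ->: (\sum_(z in Z) actr u (h * z)%g = 0)%R.
  rewrite -[RHS](sumZ (actr u h)); apply: eq_bigr => z Zz.
  by rewrite actrM // (subsetP nVZ).
have ->: (\sum_(z in Z) actr u (h * z)^-1%g = 0)%R.
  transitivity (actr (\sum_(z in Z) actr u z)%R h^-1).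
    rewrite actr_sum (reindex_inj invg_inj) /=.
    apply: eq_big => [z | z Zz]; first by rewrite groupV.
    rewrite invMg invgK actrM ?groupV //.
    by rewrite (subsetP nVZ) // -groupV.
  by rewrite sumZ act0r.
(* Only the constant terms survive: [#|Z|] copies of [u]. *)
rewrite !GRing.addr0 GRing.sumr_const => /(congr1 val).
by rewrite fmvalZ fmodK.
Qed.

Lemma mulgg_order3 (gT : finGroupType) (g : gT) : g ^+ 3 = 1 -> g * g = g^-1.
Proof. by move=> g3; apply: (mulIg g); rewrite mulVg -mulgA -g3. Qed.

Lemma order3_powers (gT : finGroupType) (x y : gT) :
  x ^+ 3 = 1 -> y \in <[x]> -> y != 1 -> y = x \/ y^-1 = x.
Proof.
move=> x3 /cycleP[i ->]; rewrite -(expg_mod i x3).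
have: i %% 3 < 3 by rewrite ltn_mod.
case: (i %% 3) => [|[|[]]] // _; first by rewrite eqxx.
  by left.
by move=> _; right; rewrite expgS expg1 (mulgg_order3 x3) invgK.
Qed.

(** * Groups whose nontrivial elements have order 3 or 7 *)

Section Orders37.

Variables (gT : finGroupType) (G : {group gT}).
Implicit Types (V P : {group gT}) (x g h v : gT).

Hypothesis ordG : forall x, x \in G -> x != 1 -> #[x] = 3 \/ #[x] = 7.

Lemma order_in_pgroup p (H : {group gT}) x :
  prime p -> p.-group H -> H \subset G -> x \in H -> x != 1 -> #[x] = p.
Proof.
move=> pr_p pH sHG Hx ntx; have := mem_p_elt pH Hx; rewrite /p_elt.
by case: (ordG (subsetP sHG x Hx) ntx) => ->; rewrite pnatE // => /eqnP.
Qed.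

(** The product would have order 21. *)
Lemma order_3_7_not_commute x y :
  x \in G -> y \in G -> #[x] = 3 -> #[y] = 7 -> ~ commute x y.
Proof.
move=> Gx Gy ox oy cxy.
have oxy: #[x * y] = 21%N by rewrite orderM ?ox ?oy.
have ntxy: x * y != 1 by rewrite -order_gt1 oxy.
by case: (ordG (groupM Gx Gy) ntxy); rewrite oxy.
Qed.

(* The averaging lemma applies with Z = <[x]>: for g in hZ the element w * g^-1
   lies in the 3-group V<[g]>, and its cube is w * w^g * w^(g^-1). *)
Lemma abelian_normal_3subgroup_trivial V x h :
    V <| G -> abelian V -> 3.-group V -> x \in G -> h \in G ->
    #[x] = 7 -> #[h] = 3 -> x ^ h \in <[x]> -> x ^ h != x ->
  V :=: 1.
Proof.
move=> /andP[sVG nVG] abV p3V Gx Gh ox oh xhx xhne.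
apply/trivgP/subsetP=> v Vv; rewrite inE; apply/negPn/negP=> ntv.
have o3 w : w \in V -> w != 1 -> #[w] = 3.
  exact: order_in_pgroup p3V sVG.
have sXG: <[x]> \subset G by rewrite cycle_subG.
have cVX: 'C_V(<[x]>) = 1.
  apply/trivgP/subsetP=> w /setIP[Vw /centP cw]; rewrite inE.
  apply/negPn/negP=> ntw; apply: (order_3_7_not_commute _ Gx (o3 w Vw ntw) ox).
    exact: (subsetP sVG).
  by apply: cw; rewrite cycle_id.
have V7: v ^+ #|<[x]>| = 1.
  apply: (expg_card_fixfree (h := h) abV _ _ cVX _ Vv).
  - exact: subset_trans nVG.
  - exact: (subsetP nVG).
  move=> g w /lcosetP[z xz ->{g}] Vw.
  have Gg: h * z \in G by rewrite groupM // (subsetP sXG).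
  (* [z] centralizes [<[x]>], which contains [x ^ h]. *)
  have xg: x ^ (h * z) = x ^ h.
    have /cycleP[i xhi] := xhx; have /cycleP[j zj] := xz.
    rewrite conjgM xhi conjXg zj; congr (_ ^+ i).
    exact/conjg_fixP/commgP/commuteX.
  move: (h * z) Gg xg => {xz} g Gg xg.
  have xgm m : x ^ (g ^+ m) = x ^ (h ^+ m).
    elim: m => // m IHm; have /cycleP[i xhi] := xhx.
    by rewrite !expgS !conjgM xg xhi !conjXg IHm.
  have o3g : #[g] = 3.
    have ntg: g != 1.
      by apply: contraNneq xhne => g1; rewrite -xg g1 conjg1.
    (* If [g] had order 7, then [g ^+ 7 = 1] would fix [x], but it acts on [x] as [h ^+ 7 = h]. *)
    case: (ordG Gg ntg) => // og; case/eqP: xhne.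
    have := xgm 7; rewrite -{1}og expg_order conjg1.
    by rewrite -(expg_mod 7 (expg_order h)) oh expg1 => <-.
  have g3: g ^+ 3 = 1 by rewrite -o3g expg_order.
  have ggV : g * g = g^-1 by exact: mulgg_order3.
  have: (w * g^-1) ^+ 3 = 1.
    have p3Vg: 3.-group (V <*> <[g]>).
      rewrite norm_joinEr ?cycle_subG ?(subsetP nVG) // pgroupM p3V.
      by rewrite /pgroup -orderE o3g.
    have sVgG: V <*> <[g]> \subset G by rewrite join_subG sVG cycle_subG.
    have [-> | ntwg] := eqVneq (w * g^-1) 1; first by rewrite expg1n.
    rewrite -(order_in_pgroup _ p3Vg sVgG _ ntwg) ?expg_order //.
    by rewrite groupM ?groupV ?mem_gen // inE ?Vw ?cycle_id ?orbT.
  rewrite !expgS expg0 mulg1 /conjg invgK => <-.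
  by rewrite -ggV !mulgA.
by move/eqP: V7; rewrite -order_dvdn -orderE ox (o3 v Vv ntv).
Qed.

(* Here Z has order 3 in P and h lies in P \ Z: for g in hZ the element
   w * w^g * w^(g^-1) is fixed by g, hence trivial. *)
Lemma Sylow3_small V P :
    V <| G -> abelian V -> 7.-group V -> V :!=: 1 -> P \subset G ->
    3.-group P -> #|P| <= 3.
Proof.
move=> /andP[sVG nVG] abV p7V ntV sPG p3P; rewrite leqNgt; apply/negP=> P_gt3.
have [v Vv ntv] := trivgPn _ ntV.
have ov : #[v] = 7.
  exact: order_in_pgroup p7V sVG Vv ntv.
have fixfree g w : g \in P -> g != 1 -> w \in V -> commute w g -> w = 1.
  move=> Pg ntg Vw cwg; apply/eqP/negPn/negP=> ntw.
  apply: (order_3_7_not_commute (subsetP sPG g Pg) (subsetP sVG w Vw));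
    last exact/commute_sym.
    exact: order_in_pgroup p3P sPG Pg ntg.
  exact: order_in_pgroup p7V sVG Vw ntw.
have oP g : g \in P -> g != 1 -> #[g] = 3.
  exact: order_in_pgroup p3P sPG.
have /trivgPn[z Pz ntz] : P :!=: 1.
  by rewrite -cardG_gt1; apply: leq_trans P_gt3.
have sZP: <[z]> \subset P by rewrite cycle_subG.
have /subsetPn[h Ph Zh] : ~~ (P \subset <[z]>).
  by apply: contraL P_gt3 => /subset_leq_card; rewrite -leqNgt -orderE oP.
have V3: v ^+ #|<[z]>| = 1.
  apply: (expg_card_fixfree (h := h) abV _ _ _ _ Vv).
  - exact: subset_trans (subset_trans sPG nVG).
  - by rewrite (subsetP nVG) ?(subsetP sPG).
  - apply/trivgP/subsetP=> w /setIP[Vw /centP cw]; apply/set1P.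
    by apply: (fixfree z) => //; apply: cw; rewrite cycle_id.
  move=> g w /lcosetP[y Zy ->{g}] Vw.
  have Pg: h * y \in P by rewrite groupM // (subsetP sZP).
  have ntg: h * y != 1.
    by apply: contraNneq Zh => /(canRL (mulgK _)) ->;
      rewrite mul1g groupV.
  move: (h * y) Pg ntg => {Zy} g Pg ntg.
  have nVg: g \in 'N(V) by rewrite (subsetP nVG) ?(subsetP sPG).
  have [Vwg VwgV]: w ^ g \in V /\ w ^ g^-1 \in V by rewrite !memJ_norm ?groupV.
  apply: (fixfree g) => //; first by rewrite groupM // groupM.
  apply/commgP/conjg_fixP.
  have g3: g ^+ 3 = 1 by rewrite -(oP g Pg ntg) expg_order.
  have ggV : g * g = g^-1 by exact: mulgg_order3.
  (* Conjugation by [g] permutes the three factors cyclically, and [V] is abelian. *)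
  rewrite 2!conjMg -2!conjgM mulVg conjg1 ggV.
  by rewrite -(centsP abV w Vw _ (groupM Vwg VwgV)) mulgA.
by move/eqP: V3; rewrite -order_dvdn -orderE ov oP.
Qed.

(** Coprime orders make [H] a complement of [N]; its action is semiregular because elements of
    orders 3 and 7 never commute. *)
Lemma Frobenius_orders_3_7 (N H : {group gT}) :
    N <| G -> 7.-group N -> N :!=: 1 -> #|G : N| = 3 ->
    H \subset G -> #|H| = 3 ->
  [Frobenius G = N ><| H].
Proof.
move=> /andP[sNG nNG] p7N ntN iGN sHG oH.
have tiNH: N :&: H = 1.
  by apply: coprime_TIg; rewrite oH; apply: pnat_coprime p7N _.
have defG: N ><| H = G.
  rewrite sdprodE ?(subset_trans sHG) //; apply/eqP.
  by rewrite eqEcard mul_subG //= TI_cardMg // oH -(Lagrange sNG) iGN.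
have ntH: H :!=: 1 by rewrite -cardG_gt1 oH.
apply/Frobenius_semiregularP=> // h /setD1P[nth Hh].
apply/trivgP/subsetP=> x /setIP[Nx /cent1P cxh]; rewrite inE.
apply/negPn/negP=> ntx.
have p3H: 3.-group H by rewrite /pgroup oH.
apply: (order_3_7_not_commute (subsetP sHG h Hh) (subsetP sNG x Nx)).
- exact: (order_in_pgroup _ p3H sHG Hh nth).
- exact: (order_in_pgroup _ p7N sNG Nx ntx).
exact/commute_sym.
Qed.

Lemma prime_dvd_orders_3_7 n : n %| #|G| -> prime n -> n = 3 \/ n = 7.
Proof.
move=> nG pr_n; have [x Gx ox] := Cauchy pr_n nG.
by rewrite -ox; apply: ordG => //; rewrite -order_gt1 ox prime_gt1.
Qed.

Lemma orders_3_7_solvable : solvable G.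
Proof.
apply: Burnside_p_a_q_b.
apply: (@uniq_leq_size _ _ [:: 3; 7]); first exact: primes_uniq.
move=> p; rewrite mem_primes => /and3P[pr_p _ pG].
by case: (prime_dvd_orders_3_7 pG pr_p) => ->.
Qed.

End Orders37.

(** * Normality and index of the Sylow 7-subgroup *)

Lemma Sylow7_normal_index3 (gT : finGroupType) (G : {group gT})
    (oddG : odd #|G|) (fG : fused_powers G) :
    7 %| #|G| ->
  exists N : {group gT}, [/\ N <| G, 7.-group N, N :!=: 1 & #|G : N| = 3].
Proof.
have ordG x : x \in G -> x != 1 -> #[x] = 3 \/ #[x] = 7.
  by move=> Gx ntx; case: (fused_powers_order oddG fG Gx ntx) => [|[]]; auto.
move=> G7; have [x Gx ox] := Cauchy (isT : prime 7) G7.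
have ntx: x != 1 by rewrite -order_gt1 ox.
have [|[_ [h [Gh oh xhx xhne]]]] := fused_powers_order oddG fG Gx ntx.
  by rewrite ox.
have ntG: G :!=: 1 by apply/trivgPn; exists x.
have [V minV sVG] := minnormal_exists ntG (normG G).
have [nVG ntV /is_abelemP[p pr_p abelV]] :=
  minnormal_solvable minV sVG (orders_3_7_solvable ordG).
have nsVG: V <| G by apply/andP.
have [pV abV _] := and3P abelV.
have pG: p %| #|G|.
  apply: dvdn_trans (cardSg sVG).
  by have [] := pgroup_pdiv pV ntV.
have [P sylP] := Sylow_exists 3 G; have [sPG p3P _] := and3P sylP.
have [Q sylQ] := Sylow_exists 7 G; have [sQG p7Q _] := and3P sylQ.
have p7V: 7.-group V.
  case: (prime_dvd_orders_3_7 ordG pG pr_p) => p37; rewrite p37 in pV => //.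
  case/eqP: ntV.
  exact: (abelian_normal_3subgroup_trivial ordG nsVG abV pV Gx Gh).
have oP: #|P| = 3.
  have P_le3 := Sylow3_small ordG nsVG abV p7V ntV sPG p3P.
  apply/eqP; rewrite eqn_leq P_le3 dvdn_leq //.
  rewrite (card_Hall sylP) -[X in X %| _]/(3 ^ 1)%N p_part dvdn_exp2l //.
  by rewrite -(pfactor_dvdn 1) // -oh order_dvdG.
have ntQ: Q :!=: 1.
  rewrite -cardG_gt1 (card_Hall sylQ) p_part_gt1.
  by rewrite mem_primes cardG_gt0.
(* The index is the [7^']-part of [#|G|], which is its 3-part as no other primes occur. *)
have iGQ: #|G : Q| = 3.
  rewrite -divgS // (card_Hall sylQ) -[RHS]oP (card_Hall sylP).
  rewrite -{1}(partnC 7 (cardG_gt0 G)) mulKn //.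
  apply: eq_in_partn => q; rewrite mem_primes => /and3P[pr_q _ qG].
  by case: (prime_dvd_orders_3_7 ordG qG pr_q) => ->.
exists Q; split=> //; apply/andP; split=> //.
(* The number of Sylow 7-subgroups divides 3 and is 1 modulo 7, so it is 1. *)
have syl_dv3: #|'Syl_7(G)| %| 3.
  by rewrite (card_Syl sylQ) -iGQ indexgS // subsetI sQG normG.
have syl_mod := card_Syl_mod G (isT : prime 7).
have: #|G : 'N_G(Q)| == 1%N.
  rewrite -(card_Syl sylQ); move: syl_mod (dvdn_leq (isT : 0 < 3) syl_dv3).
  by case: #|_| => [|[|[|[]]]].
by rewrite indexg_eq1 subsetI => /andP[].
Qed.

(** * The converse for Frobenius groups *)

Lemma Frobenius21_fused_powers (gT : finGroupType) (G N : {group gT}) a :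
    #|G| = (3 * 7 ^ a)%N -> [Frobenius G with kernel N] -> exponent N = 7 ->
    (forall x, x \in N -> x != 1 ->
       exists H : {group gT}, [/\ [Frobenius G with complement H], #|H| = 3
                   & H \subset 'N_G(<[x]>)]) ->
  fused_powers G.
Proof.
move=> oG frobG expN compN.
have [ntN _ /andP[sNG nNG] cN] := Frobenius_kerP frobG.
have xN7 x : x \in N -> x ^+ 7 = 1 by rewrite -expN; apply: expg_exponent.
have p7N: 7.-group N.
  by rewrite -pnat_exponent expN.
have iGN: #|G : N| %| 3.
  have coNi: coprime #|N| #|G : N| := Frobenius_ker_coprime frobG.
  have [_ N7 _] := pgroup_pdiv p7N ntN.
  rewrite -(@Gauss_dvdl _ 3 (7 ^ a)); last first.
    by rewrite coprimeXr // coprime_sym (coprime_dvdl N7).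
  by rewrite -oG dvdn_indexg.
move=> x y Gx xy nty; have [Nx | N'x] := boolP (x \in N); last first.
  (* Otherwise [x ^+ 3] is a nontrivial element of [N], whose centralizer lies in [N] and contains
     [x]. *)
  suff x3: x ^+ 3 = 1.
    have [->|->] := order3_powers x3 xy nty; rewrite class_refl; auto.
  apply/eqP; apply: contraR N'x => ntx3.
  have Nx3: x ^+ 3 \in N.
    have nNx := subsetP nNG x Gx.
    apply: coset_idr; first exact: groupX.
    rewrite morphX //; apply/eqP; rewrite -order_dvdn.
    apply: dvdn_trans iGN; rewrite -card_quotient //.
    by rewrite order_dvdG ?mem_quotient.
  apply: (subsetP (cN (x ^+ 3) _)); first by rewrite !inE ntx3.
  by rewrite inE Gx; apply/cent1P/commuteX.
have ntx: x != 1.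
  by apply: contraNneq nty => x1; move: xy; rewrite x1 cycle1 => /set1P->.
have x7 := xN7 x Nx.
have [H [_ oH]] := compN x Nx ntx; rewrite subsetI => /andP[sHG nxH].
have /trivgPn[h Hh nth]: H :!=: 1 by rewrite -cardG_gt1 oH.
have h3: h ^+ 3 = 1 by rewrite -oH; apply: expg_cardG.
have Gh := subsetP sHG h Hh.
have xhne : x ^ h != x.
  apply: contra nth => /eqP xh; rewrite -order_eq1 -dvdn1.
  have Nh: h \in N.
    apply: (subsetP (cN x _)); first by rewrite !inE ntx.
    by rewrite inE Gh; apply/cent1P/esym/commgP/conjg_fixP.
  by rewrite -[1%N]/(gcdn 3 7) dvdn_gcd !order_dvdn h3 xN7 ?eqxx.
have ox: #[x] = 7.
  by apply/prime_nt_dvdP; rewrite ?order_eq1 // order_dvdn x7.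
have: x ^ h \in <[x]> by rewrite -norms_cycle cycle_subG (subsetP nxH).
case/cycleP=> k; rewrite -(expg_mod k x7).
have: k %% 7 < 7 by rewrite ltn_mod.
move: (k %% 7) => {}k k_lt7 xh.
have xhm m : x ^+ (k ^ m) = x ^ (h ^+ m).
  elim: m => [|m IHm]; first by rewrite conjg1.
  by rewrite expgSr conjgM -IHm conjXg xh -expgM expnS.
(* Conjugation by powers of [h] reaches the exponents in the subgroup generated by [k] modulo 7. It
   has order 3, so it is {1, 2, 4}, and with its negatives it covers all nonzero residues. *)
have clx i : i = k ^ 0 %[mod 7] \/ i = k ^ 1 %[mod 7] \/ i = k ^ 2 %[mod 7] ->
  x ^+ i \in x ^: G.
- have cl m : i = k ^ m %[mod 7] -> x ^+ i \in x ^: G.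
    move=> im; rewrite -(expg_mod i x7) im expg_mod // xhm.
    by rewrite memJ_class ?groupX.
  by case=> [|[]]; apply: cl.
have k24: k = 2 \/ k = 4.
  have: k ^ 3 == 1 %[mod 7].
    by rewrite -ox -eq_expg_mod_order xhm h3 conjg1 expg1.
  have: k != 1%N by apply: contraNneq xhne => k1; rewrite xh k1 expg1.
  by clear -k_lt7; case: k k_lt7 => [|[|[|[|[|[|[|]]]]]]] // _ _; auto.
have /cycleP[i] := xy; rewrite -(expg_mod i x7).
have: i %% 7 < 7 by rewrite ltn_mod.
move: (i %% 7) => {}i i_lt7 defy.
have yV: y^-1 = x ^+ (7 - i).
  by apply: (mulIg y); rewrite mulVg defy -expgD subnK // ltnW.
have: (i == 0) || ((i \in [:: 1%N; 2; 4]) || (7 - i \in [:: 1%N; 2; 4])).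
  by clear -i_lt7; case: i i_lt7 => [|[|[|[|[|[|[|]]]]]]].
case/or3P=> [/eqP i0 | i124 | i124].
- by case/eqP: nty; rewrite defy i0.
- left; rewrite defy; apply: clx; move: i124; rewrite !inE.
  by case: k24 => -> /or3P[] /eqP->; auto.
right; rewrite yV; apply: clx; move: i124; rewrite !inE.
by case: k24 => -> /or3P[] /eqP->; auto.
Qed.


(** * Assembling the two directions of the classification *)

(* In case (1), "exponent 3" is x ^+ 3 = 1 for all x (exponent dividing 3), so
   that the trivial group, whose graph is empty, is included. *)
Theorem theorem2p3 (gT : finGroupType) (G : {group gT}) (oddG : odd #|G|) :
  cyclic_class_graph_triangle_free G
  <->
  (3.-group G /\ exponent G %| 3)
  \/
  (exists a : nat,
     [/\ 0 < a,
         #|G| = (3 * 7 ^ a)%N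
       & exists N : {group gT},
           [/\ [Frobenius G with kernel N],
               exponent N = 7
             & forall x : gT, x \in N -> x != 1 ->
                 exists H : {group gT},
                   [/\ [Frobenius G with complement H],
                       #|H| = 3
                     & H \subset 'N_G(<[x]>)]]]).
Proof.
rewrite (triangle_free_fused_powers oddG); split=> [fG | [[_ expG] | ]].
- have ordG x : x \in G -> x != 1 -> #[x] = 3 \/ #[x] = 7.
    by move=> Gx ntx; case: (fused_powers_order oddG fG Gx ntx) => [|[]]; auto.
  (* Divisibility by 7 separates the Frobenius case from the exponent 3 case. *)
  have [G7 | G'7] := boolP (7 %| #|G|); [right | left].
    have [N [nsNG p7N ntN iGN]] := Sylow7_normal_index3 oddG fG G7.
    have [sNG nNG] := andP nsNG.
    have frob (H : {group gT}) :
        H \subset G -> #|H| = 3 -> [Frobenius G = N ><| H].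
      exact: Frobenius_orders_3_7.
    have oN x : x \in N -> x != 1 -> #[x] = 7.
      exact: (order_in_pgroup ordG _ p7N).
    have comp x : x \in N -> x != 1 -> exists H : {group gT},
        [/\ [Frobenius G = N ><| H], #|H| = 3 & H \subset 'N_G(<[x]>)].
    - move=> Nx ntx; have ox := oN x Nx ntx.
      have [ox3 | [_ [h [Gh oh xhx _]]]] :=
        fused_powers_order oddG fG (subsetP sNG x Nx) ntx.
        by rewrite ox3 in ox.
      have shG: <[h]> \subset G by rewrite cycle_subG.
      (* Any subgroup of order 3 is a complement, so the one generated by an [h] normalizing [<[x]>]
         serves. *)
      exists <[h]>%G; split=> //; first exact: frob.
      by rewrite subsetI shG norms_cycle.
    have [x Nx ntx] := trivgPn _ ntN.
    exists (logn 7 #|N|); split.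
    + rewrite logn_gt0 mem_primes cardG_gt0 /=.
      by rewrite -(oN x Nx ntx) order_dvdG.
    + by rewrite -(Lagrange sNG) iGN mulnC -(card_pgroup p7N).
    exists N; split.
    + by have [H [/FrobeniusWker]] := comp x Nx ntx.
    + apply/eqP; rewrite eqn_dvd -{2}(oN x Nx ntx) dvdn_exponent // andbT.
      apply/exponentP=> y Ny; have [-> | nty] := eqVneq y 1.
        by rewrite expg1n.
      by rewrite -(oN y Ny nty) expg_order.
    move=> y Ny nty; have [H [frobH oH nH]] := comp y Ny nty.
    by exists H; split=> //; apply: FrobeniusWcompl frobH.
  split.
    apply/pgroupP=> p pr_p pG.
    by case: (prime_dvd_orders_3_7 ordG pG pr_p) => [->|p37] //;
      case/negP: G'7; rewrite -p37.
  apply/exponentP=> x Gx; have [-> | ntx] := eqVneq x 1.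
    by rewrite expg1n.
  case: (ordG x Gx ntx) => ox; first by rewrite -ox expg_order.
  by case/negP: G'7; rewrite -ox order_dvdG.
- move=> x y Gx xy nty; have x3 := exponentP expG x Gx.
  by have [->|->] := order3_powers x3 xy nty; rewrite class_refl; auto.
case=> a [_ oG [N [frobG expN comp]]].
exact: Frobenius21_fused_powers oG frobG expN comp.
Qed.
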